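(* There exist an absolute constant $\epsilon_0>0$, a function $\eta:(0,\epsilon_0]\to[0,\infty)$ with $\eta(\epsilon)\to0$ as $\epsilon\to0$, and a function $d_0:(0,\epsilon_0]\to\mathbb{N}$ with $\epsilon\, d_0(\epsilon)<1$ for all $\epsilon$, such that for every $0<\epsilon\le\epsilon_0$ and every integer $d\ge d_0(\epsilon)$ with $\epsilon d<1$ there exist a finite set $P_\epsilon\subset(\mathbb{R}^d,\|\cdot\|_1)$ and a point $s\in P_\epsilon$ such that every $(1+\epsilon,\beta)$-shallow-light tree for $P_\epsilon$ rooted at $s$ (with respect to the $\ell_1$ metric) has $\beta>(2-\eta(\epsilon))\frac1\epsilon$.
   Context: For a finite point set $P\subset\mathbb{R}^d$, consider the complete graph on $P$ in which each edge $xy$ has weight $w(x,y)=\|x-y\|_1$. For a graph $H$ on $P$, $w(H)$ is the sum of its edge weights, and $\mathrm{dist}_H$ is the weighted shortest-path distance in $H$. Let $\mathrm{MST}(P)$ be a minimum-weight spanning tree of this complete graph. For $\alpha,\beta\ge 1$ and $s\in P$, an $(\alpha,\beta)$-shallow-light tree (SLT) for $P$ rooted at $s$ is a spanning tree $T$ of the complete graph on $P$ (no Steiner points) such that $\mathrm{dist}_T(s,t)\le\alpha\cdot w(s,t)$ for all $t\in P$, and $w(T)\le\beta\cdot w(\mathrm{MST}(P))$. *)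

(* Defs.v *)
From HB Require Import structures.
From mathcomp Require Import all_boot all_order all_algebra finmap.
From mathcomp Require Import all_classical all_reals all_analysis.
Import numFieldNormedType.Exports.
Import Order.TTheory GRing.Theory Num.Theory.

Set Implicit Arguments.
Unset Strict Implicit.
Unset Printing Implicit Defensive.

Local Open Scope classical_set_scope.
Local Open Scope ring_scope.

Definition l1dist (R : realType) (d : nat) (x y : 'rV[R]_d) : R :=
  \sum_(i < d) `|x 0 i - y 0 i|.

Section WeightedGraph.
Variables (R : realType) (V : finType) (w : V -> V -> R).
Implicit Types (e : rel V) (x y s : V) (p c : seq V).

(* A graph on V is given by its adjacency relation.  [ucycle] accepts the
   back-and-forth walk x, y, x along a single edge, as a cyclic sequence of
   size 2; the cycles of a simple graph are those of size at least 3. *)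
Definition spanning_tree e : Prop :=
  [/\ symmetric e, irreflexive e, (forall x y, connect e x y)
    & forall c, ucycle e c -> (size c <= 2)%N].

(* Each edge occurs as two ordered pairs, hence the division by 2 (w is meant
   to be symmetric). *)
Definition graph_weight e : R := (\sum_x \sum_(y | e x y) w x y) / 2.

(* [pairmap w x p] lists the weights of the successive edges of x :: p. *)
Definition path_weight x p : R := \sum_(r <- pairmap w x p) r.

(* Extended-real valued, so that unconnected vertices are at distance +oo. *)
Definition graph_dist e x y : \bar R :=
  ereal_inf [set (path_weight x p)%:E | p in
    [set p | [/\ path e x p, uniq (x :: p) & last x p = y]]].

Definition minimum_spanning_tree e : Prop :=
  spanning_tree e /\
  forall e', spanning_tree e' -> graph_weight e <= graph_weight e'.

(* All minimum spanning trees have the same weight, and there is at least one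
   when V is nonempty; the last clause thus bounds the weight of T by beta times
   that common weight. *)
Definition shallow_light_tree (alpha beta : R) s e : Prop :=
  [/\ 1 <= alpha, 1 <= beta, spanning_tree e,
      (forall t, (graph_dist e s t <= (alpha * w s t)%:E)%E)
    & forall m, minimum_spanning_tree m ->
        graph_weight e <= beta * graph_weight m].

End WeightedGraph.

Definition l1_shallow_light_tree (R : realType) (d : nat)
    (P : {fset 'rV[R]_d}) (alpha beta : R) (s : P) (e : rel P) : Prop :=
  shallow_light_tree (fun x y : P => l1dist (val x) (val y)) alpha beta s e.

(* Main.v *)
(* Write k = 2/eps - 1, a = k/d > 1 and c = (a, ..., a), so that c has l1 norm k.
   The points are the root 0, the center c, the hubs c + e_i and the leaves
   c + e_i - e_j (i != j).  A leaf has norm k, every other point except 0 has norm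
   k or k + 1, and a path from 0 to a leaf with an intermediate vertex has length
   at least k + 2 > (1 + eps) k; hence each of the d(d-1) leaves is adjacent to 0
   in a shallow-light tree, which weighs at least d(d-1)k.  The tree going from 0
   to c, from c to the hubs and from c + e_i to the leaves c + e_i - e_j weighs
   only k + d^2.  For d of order 1/eps the ratio is (1 - O(eps)) k. *)
Require Import Defs.
From HB Require Import structures.
From mathcomp Require Import all_boot all_order all_algebra finmap.
From mathcomp Require Import all_classical all_reals all_analysis.
From mathcomp Require Import ring lra.
Import numFieldNormedType.Exports.
Import Order.TTheory GRing.Theory Num.Theory.

Set Implicit Arguments.
Unset Strict Implicit.
Unset Printing Implicit Defensive.

Local Open Scope classical_set_scope.
Local Open Scope ring_scope.

(** Relations on [V] are encoded as sets of ordered pairs, which form a finite type, so the minimum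
    is attained. The weight clause of [shallow_light_tree] ranges over all minimum spanning trees
    and has content only because one exists. *)
Lemma minimum_spanning_tree_exists (R : realType) (V : finType)
    (w : V -> V -> R) (e : rel V) :
  spanning_tree e ->
  exists2 m, minimum_spanning_tree w m & graph_weight w m <= graph_weight w e.
Proof.
move=> te.
pose rel_of (A : {set V * V}) : rel V := fun x y => (x, y) \in A.
have rel_ofK (f : rel V) : exists A, rel_of A = f.
  exists [set u | f u.1 u.2]%SET.
  by apply/funext => x; apply/funext => y; rewrite /rel_of inE.
have [A0 eA0] := rel_ofK e.
have PA0 : `[< spanning_tree (rel_of A0) >] by apply/asboolP; rewrite eA0.
case: (@arg_minP _ _ _ A0 (fun A => `[< spanning_tree (rel_of A) >])
  (fun A => graph_weight w (rel_of A)) PA0) => A /asboolP tA minA.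
exists (rel_of A); last by rewrite -eA0; apply: minA.
split=> // e' te'; have [B eB] := rel_ofK e'.
by rewrite -eB; apply: minA; apply/asboolP; rewrite eB.
Qed.

(** * Spanning trees given by a parent map *)

Section ParentTree.
Variables (V : finType) (r : V) (par : V -> V) (depth : V -> nat).
Hypothesis depth_par : forall x, x != r -> (depth (par x) < depth x)%N.

Definition parent_rel : rel V :=
  fun x y => (x != r) && (par x == y) || (y != r) && (par y == x).

Lemma parent_rel_depth x y :
  parent_rel x y -> (depth y <= depth x)%N -> y = par x.
Proof.
case/orP => /andP[nr /eqP<-] // le_d.
by have := depth_par nr; rewrite ltnNge le_d.
Qed.

Lemma parent_rel_spanning_tree : spanning_tree parent_rel.
Proof.
have syme : symmetric parent_rel by move=> x y; rewrite /parent_rel orbC.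
split=> //.
- move=> x; apply/negP; rewrite /parent_rel orbb => /andP[/depth_par xr /eqP xx].
  by rewrite xx ltnn in xr.
- have to_root x : connect parent_rel x r.
    have [n] := ubnP (depth x); elim: n x => // n IHn x le_n.
    have [->//|xr] := eqVneq x r.
    apply: (connect_trans (connect1 _) (IHn (par x) _)).
      by rewrite /parent_rel xr eqxx.
    exact: leq_trans (depth_par xr) le_n.
  move=> x y; apply: connect_trans (to_root x) _.
  by rewrite (sym_connect_sym syme).
- move=> c /andP[cyc uc]; rewrite leqNgt; apply/negP => sz.
  (* Both neighbours of a deepest vertex of the cycle are its parent. *)
  have [x0 x0c] : exists x, x \in c.
    by case: c sz {cyc uc} => // x c _; exists x; rewrite mem_head.
  case: (@arg_maxnP _ x0 (fun x => x \in c) depth x0c) => x xc maxx.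
  case/rot_to: (xc) => i q def_c.
  have: cycle parent_rel (x :: q) by rewrite -def_c rot_cycle.
  have: uniq (x :: q) by rewrite -def_c rot_uniq.
  have: (1 < size q)%N by rewrite -ltnS -[(size q).+1]/(size (x :: q)) -def_c size_rot.
  have qP y : y \in q -> (depth y <= depth x)%N.
    by move=> yq; apply: maxx; rewrite -(mem_rot i) def_c inE yq orbT.
  (* As the cycle has at least 3 vertices, the successor [y] and the predecessor [z] of [x] are
     distinct. *)
  case: q {def_c} qP => [//|y q] qP; case/lastP: q qP => [//|q z] qP _.
  rewrite cons_uniq => /andP[_]; rewrite cons_uniq mem_rcons inE => /andP[+ _].
  rewrite /cycle rcons_path /= last_rcons => /norP[/eqP yz _] /andP[/andP[exy _] ezx].
  apply: yz; rewrite (parent_rel_depth exy); last by rewrite qP ?mem_head.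
  rewrite syme in ezx; rewrite (parent_rel_depth ezx) //.
  by rewrite qP // inE mem_rcons mem_head orbT.
Qed.

Lemma parent_rel_weight (R : realType) (w : V -> V -> R) :
  (forall x y, w x y = w y x) ->
  graph_weight w parent_rel = \sum_(x | x != r) w x (par x).
Proof.
move=> symw.
(* The two disjuncts of [parent_rel] exclude each other, since depth would decrease both ways. Each
   edge is thus charged to its child end, once per ordered pair. *)
have half x y : (if parent_rel x y then w x y else 0) =
    (if (x != r) && (par x == y) then w x y else 0) +
    (if (y != r) && (par y == x) then w y x else 0).
  rewrite /parent_rel.
  have [/andP[xr /eqP xy]|_] := boolP (_ && _); last first.
    by rewrite add0r /= symw.
  have [/andP[yr /eqP yx]|_] := boolP ((y != r) && _); last by rewrite addr0.
  by have := depth_par xr; rewrite xy ltnNge -{1}yx (ltnW (depth_par yr)).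
have sum1 x : \sum_y (if (x != r) && (par x == y) then w x y else 0) =
    if x != r then w x (par x) else 0.
  case: ifPn => xr /=; last by rewrite big1.
  by rewrite -big_mkcond (big_pred1 (par x)) // => y; rewrite /= eq_sym.
rewrite /graph_weight.
under eq_bigr do rewrite big_mkcond /=.
under eq_bigr do (under eq_bigr do rewrite half; rewrite big_split /=).
rewrite big_split /= [X in _ + X]exchange_big /=.
under eq_bigr do rewrite sum1.
by rewrite [RHS]big_mkcond /=; field.
Qed.
End ParentTree.

(** * Edges forced by short distances, and the weight they carry *)

Section DirectEdges.
Variables (R : realType) (V : finType) (w : V -> V -> R).
Hypothesis w_ge0 : forall x y, 0 <= w x y.
Hypothesis w_sym : forall x y, w x y = w y x.
Hypothesis w_refl : forall x, w x x = 0.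
Hypothesis w_tri : forall x y z, w x z <= w x y + w y z.

Lemma path_weight_ge x p : w x (last x p) <= path_weight w x p.
Proof.
rewrite /path_weight; elim: p x => [|y p IHp] x /=.
  by rewrite w_refl big_nil.
by rewrite big_cons (le_trans (w_tri x y _)) // lerD2l.
Qed.

(** Some path from [s] to [t] is shorter than [b]. Were [s] and [t] not adjacent, the vertex before
    [t] on it would differ from both, and by the triangle inequality the path would be at least as
    long as the detour through that vertex. *)
Lemma graph_dist_edge (e : rel V) s t (b : R) :
  irreflexive e -> s != t ->
  (forall x, x != s -> x != t -> b <= w s x + w x t) ->
  (graph_dist w e s t < b%:E)%E -> e s t.
Proof.
move=> irre st detour /ereal_inf_lt[_ [p [ep _ lp] <-]]; rewrite lte_fin.
apply: contraTT => nst; rewrite -leNgt.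
case/lastP: p ep lp => [_ /= est|p y].
  by rewrite est eqxx in st.
rewrite last_rcons rcons_path => /andP[_ eyt] yt; rewrite yt in eyt *.
rewrite /path_weight -cats1 pairmap_cat /= big_cat /= big_seq1.
apply: (@le_trans _ _ (w s (last s p) + w (last s p) t)).
  apply: detour; first by apply: contraNneq nst => <-.
  by apply: contraTneq eyt => ->; rewrite irre.
by rewrite lerD2r path_weight_ge.
Qed.

(** Each edge at [s] is counted in the row of [s] and again in the row of its other end, which
    offsets the division by 2. *)
Lemma star_weight_le (e : rel V) s :
  symmetric e -> irreflexive e ->
  \sum_(t | e s t) w s t <= graph_weight w e.
Proof.
move=> syme irre; rewrite /graph_weight ler_pdivlMr // mulr_natr mulr2n.
rewrite [leRHS](bigD1 s) //= lerD2l (big_mkcond (e s)) (bigD1 s) //= irre add0r.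
apply: ler_sum => x xs; case: ifPn => [esx|_]; last exact: sumr_ge0.
rewrite (bigD1 s) /=; last by rewrite syme.
by rewrite w_sym lerDl sumr_ge0.
Qed.
End DirectEdges.

Lemma sum_option (V : nmodType) (I : finType) (F : option I -> V) :
  \sum_x F x = F None + \sum_i F (Some i).
Proof.
rewrite (bigD1 None) //=; congr +%R.
rewrite (reindex_omap Some id) => [|[i|] //].
by apply: eq_bigl => i; rewrite eqxx.
Qed.

(** The trees live on the subtype of a finite set of points; the bijection lets sums over it be
    reindexed by [I]. *)
Lemma fset_codom (I : finType) (K : choiceType) (f : I -> K) :
  injective f ->
  exists (P : {fset K}) (g : I -> P), bijective g /\ forall i, val (g i) = f i.
Proof.
move=> injf; pose P : {fset K} := seq_fset tt (codom f).
have fP i : f i \in P by rewrite seq_fsetE codom_f.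
have invP (x : P) : exists i, f i == val x.
  by have := valP x; rewrite seq_fsetE => /codomP[i ->]; exists i.
exists P, (fun i => [` fP i]%fset); split=> //.
exists (fun x => xchoose (invP x)) => [i|x].
  by apply: injf; rewrite (eqP (xchooseP (invP _))).
by apply/val_inj/eqP; rewrite /= (xchooseP (invP x)).
Qed.

(** * Metric properties of the l1 distance *)

Section L1Distance.
Variables (R : realType) (d : nat).
Implicit Types x y z : 'rV[R]_d.

Lemma l1dist_ge0 x y : 0 <= l1dist x y.
Proof. exact: sumr_ge0. Qed.

Lemma l1distC x y : l1dist x y = l1dist y x.
Proof. by apply: eq_bigr => i _; rewrite distrC. Qed.

Lemma l1dist_refl x : l1dist x x = 0.
Proof. by apply: big1 => i _; rewrite subrr normr0. Qed.

Lemma l1dist_triangle x y z : l1dist x z <= l1dist x y + l1dist y z.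
Proof. by rewrite -big_split /=; apply: ler_sum => i _; apply: ler_distD. Qed.

End L1Distance.

(* The point set is indexed by option (option ('I_d * 'I_d)): [None] is the
   origin, [Some None] the center c = (a, ..., a), [Some (Some (i, i))] is
   c + e_i, and [Some (Some (i, j))] with i != j is c + e_i - e_j. *)
Section Star.
Variables (R : realType) (d : nat) (a : R).
Hypothesis a_ge1 : 1 <= a.
Local Notation center_index := (option ('I_d * 'I_d)).
Implicit Types (u v : center_index) (l : 'I_d).

Definition offset u l : R :=
  if u is Some (i, j) then (l == i)%:R - ((i != j) && (l == j))%:R else 0.

Definition level u : R := if u is Some (i, j) then (i == j)%:R else 0.

Definition star_point (x : option center_index) : 'rV[R]_d :=
  if x is Some u then \row_l (a + offset u l) else 0.

Lemma sum_delta i : \sum_(l < d) (l == i)%:R = 1 :> R.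
Proof. by rewrite (bigD1 i) //= eqxx big1 ?addr0 // => l /negPf->. Qed.

Lemma sum_offset u : \sum_l offset u l = level u.
Proof.
case: u => [[i j]|]; last by rewrite big1.
rewrite /= big_split /= sum_delta sumrN; have [_|ij] := eqVneq i j.
  by rewrite big1 ?subr0.
by rewrite sum_delta subrr.
Qed.

Lemma offset_int u l : offset u l \is a Num.int.
Proof. by case: u => [[i j]|]; rewrite /= ?rpredB ?natr_int ?int_num0. Qed.

Lemma offset_geN1 u l : - 1 <= offset u l.
Proof.
by case: u => [[i j]|] /=; [case: (l == i); case: (_ && _) => /=; lra | lra].
Qed.

Lemma offset_eq1 u l :
  (offset u l == 1) = (if u is Some (i, _) then l == i else false).
Proof.
case: u => [[i j]|] /=; last by apply/eqP => ?; lra.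
have [->|_] := eqVneq l i.
  by rewrite andNb subr0 eqxx.
by case: (_ && _) => /=; apply/eqP => ?; lra.
Qed.

Lemma offset_eqN1 u l :
  (offset u l == - 1) = (if u is Some (i, j) then (i != j) && (l == j) else false).
Proof.
case: u => [[i j]|] /=; last by apply/eqP => ?; lra.
have [->|_] := eqVneq l i.
  by rewrite andNb subr0 /=; apply/eqP => ?; lra.
by case: (_ && _) => /=; [rewrite sub0r eqxx | apply/eqP => ?; lra].
Qed.

(** The coordinate equal to 1 recovers [i]; the coordinate equal to -1 recovers [j], and its absence
    means [i = j]. Only the center has no coordinate equal to 1. *)
Lemma offset_inj u v : offset u =1 offset v -> u = v.
Proof.
move=> uv.
have eq1 l : (offset u l == 1) = (offset v l == 1) by rewrite uv.
have eqN1 l : (offset u l == - 1) = (offset v l == - 1) by rewrite uv.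
move: u v eq1 eqN1 {uv} => [[i j]|] [[i' j']|] // eq1 eqN1.
- have := eq1 i; rewrite !offset_eq1 eqxx => /esym/eqP ii'; subst i'.
  have := eqN1 j; have := eqN1 j'; rewrite !offset_eqN1 !eqxx !andbT (eq_sym j').
  have [<-//|_] := eqVneq j j'.
  by rewrite !andbF => /esym/negbFE/eqP<- /negbFE/eqP->.
- by have := eq1 i; rewrite !offset_eq1 eqxx.
- by have := eq1 i'; rewrite !offset_eq1 eqxx.
Qed.

Lemma l1dist_star_point u v :
  l1dist (star_point (Some u)) (star_point (Some v)) =
  \sum_l `|offset u l - offset v l|.
Proof. by apply: eq_bigr => l _; rewrite !mxE opprD addrACA subrr add0r. Qed.

(** Since [a >= 1] and offsets are at least -1, all coordinates are nonnegative and the norm is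
    their plain sum. *)
Lemma l1dist_origin_star_point u :
  l1dist (star_point None) (star_point (Some u)) = d%:R * a + level u.
Proof.
rewrite -sum_offset; transitivity (\sum_l (a + offset u l)).
  apply: eq_bigr => l _; rewrite !mxE sub0r normrN ger0_norm //.
  by rewrite -(subrr 1) lerD ?offset_geN1.
by rewrite big_split /= sumr_const card_ord mulr_natl.
Qed.

Lemma star_point_inj : (0 < d)%N -> injective star_point.
Proof.
move=> d_gt0.
have neq u : star_point None <> star_point (Some u).
  move=> eq0u; have := l1dist_origin_star_point u.
  rewrite -eq0u l1dist_refl; apply/eqP; rewrite lt_eqF // ltr_pwDl //.
    by rewrite mulr_gt0 ?ltr0n // (lt_le_trans ltr01).
  by case: u {eq0u} => [[i j]|] //=; rewrite ler0n.
move=> [u|] [v|] // => [/rowP uv|/esym/neq|/neq] //.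
by congr Some; apply: offset_inj => l; have := uv l; rewrite !mxE => /addrI.
Qed.

(* Distinct points differ by at least 1 in some coordinate; comparing with the
   difference of levels, the other coordinates contribute as much. *)
Lemma star_point_detour u v : u != v -> level v = 0 ->
  d%:R * a + 2 <=
  l1dist (star_point None) (star_point (Some u)) +
  l1dist (star_point (Some u)) (star_point (Some v)).
Proof.
move=> uv lv; rewrite l1dist_origin_star_point l1dist_star_point.
have [l ne_l] : exists l, offset u l - offset v l != 0.
  apply/existsP; apply: contraNT uv; rewrite negb_exists => /forallP eq_uv.
  apply/eqP/offset_inj => l; apply/eqP; rewrite -subr_eq0.
  exact: negbNE (eq_uv l).
have x1 : 1 <= `|offset u l - offset v l|.
  by apply: norm_intr_ge1 ne_l; rewrite rpredB ?offset_int.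
have xS : \sum_m (offset u m - offset v m) = level u.
  by rewrite big_split /= sumrN !sum_offset lv subr0.
have u0 : 0 <= level u by case: (u) => [[i j]|] //=; rewrite ler0n.
rewrite (bigD1 l) //= in xS; rewrite (bigD1 l) //=.
have SN := ler_norm_sum (index_enum 'I_d) (fun m => offset u m - offset v m)
  (fun m => m != l).
move: x1 xS SN; set x := _ - _; set S := \sum_(_ | _) _.
set N := \sum_(_ | _) _ => x1 xS SN.
have xu := ler_normB (level u) S; rewrite -{1}xS addrK (ger0_norm u0) in xu.
lra.
Qed.

Lemma l1dist_center_spoke i :
  l1dist (star_point (Some None)) (star_point (Some (Some (i, i)))) = 1.
Proof.
rewrite l1dist_star_point -(sum_delta i); apply: eq_bigr => l _ /=.
by rewrite eqxx subr0 sub0r normrN normr_nat.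
Qed.

Lemma l1dist_spoke_leaf i j : i != j ->
  l1dist (star_point (Some (Some (i, i)))) (star_point (Some (Some (i, j)))) = 1.
Proof.
move=> ij; rewrite l1dist_star_point -(sum_delta j); apply: eq_bigr => l _ /=.
by rewrite ij eqxx subr0 subKr normr_nat.
Qed.

End Star.

(** * The light comparison tree *)

Section StarTree.
Variable d : nat.
Implicit Types x : option (option ('I_d * 'I_d)).

Definition star_parent x :=
  if x is Some u then
    if u is Some (i, j) then Some (if i == j then None else Some (i, i))
    else None
  else None.

Definition star_depth x :=
  if x is Some u then
    if u is Some (i, j) then (if i == j then 2 else 3)%N else 1%N
  else 0%N.

Lemma star_depth_parent x :
  x != None -> (star_depth (star_parent x) < star_depth x)%N.
Proof.
case: x => [[[i j]|]|] //= _; have [_|_] := eqVneq i j => //=.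
by rewrite eqxx.
Qed.

End StarTree.

(** The bound on [eps] says that [(1 + eps) d a < d a + 2], the least length of a detour to a leaf.
    The left side of the conclusion is the weight of the forced leaf edges, the right side [beta]
    times the weight of the comparison tree. *)
Lemma star_shallow_light_weight (R : realType) (d : nat) (a eps : R) :
  (0 < d)%N -> 1 <= a -> eps * (d%:R * a) < 2 ->
  exists (P : {fset 'rV[R]_d}) (s : P), forall (beta : R) (T : rel P),
    l1_shallow_light_tree (1 + eps) beta s T ->
    d%:R * (d%:R - 1) * (d%:R * a) <= beta * (d%:R * a + d%:R ^+ 2).
Proof.
move=> d_gt0 a_ge1 eps_small.
have [P [g [g_bij gE]]] := fset_codom (star_point_inj a_ge1 d_gt0).
exists P, (g None) => beta T [_ beta_ge1 tree_T dist_T light_T].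
set w := fun _ _ => _ in dist_T light_T.
have w_ge0 x y : 0 <= w x y by exact: l1dist_ge0.
have w_sym x y : w x y = w y x by exact: l1distC.
have w_g x y : w (g x) (g y) = l1dist (star_point a x) (star_point a y).
  by rewrite /w !gE.
have [h gK hK] := g_bij.
have light_star : graph_weight w T <= beta * (d%:R * a + d%:R ^+ 2).
  pose par x := g (star_parent (h x)).
  have depth_par x : x != g None ->
      (star_depth (h (par x)) < star_depth (h x))%N.
    move=> xr; rewrite gK; apply: star_depth_parent.
    by apply: contra_neq xr => <-; rewrite hK.
  have [m mst_m] := minimum_spanning_tree_exists w
    (parent_rel_spanning_tree depth_par).
  rewrite (parent_rel_weight depth_par) // => le_m.
  apply: (le_trans (light_T m mst_m)).
  apply: ler_wpM2l; first by rewrite (le_trans ler01).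
  apply: (le_trans le_m); rewrite le_eqVlt; apply/orP; left; apply/eqP.
  rewrite (reindex g) /=; last exact: onW_bij.
  rewrite big_mkcond sum_option eqxx add0r.
  under eq_bigr => u _ do rewrite (can_eq gK) /= /par gK w_sym w_g.
  rewrite sum_option l1dist_origin_star_point // addr0; congr +%R.
  (* The [d^2] pairs index hubs and leaves together, each at distance 1 from its parent. *)
  rewrite (eq_bigr (fun=> 1)) => [|[i j] _].
    by rewrite sumr_const card_prod card_ord natrM expr2.
  rewrite /star_parent; have [<-|ij] := eqVneq i j.
    exact: l1dist_center_spoke.
  exact: l1dist_spoke_leaf.
apply: le_trans light_star; have [symT irrT _ _] := tree_T.
apply: le_trans (star_weight_le w_ge0 w_sym (g None) symT irrT).
have edge i j : i != j -> T (g None) (g (Some (Some (i, j)))).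
  move=> ij; have lvl0 : level R (Some (i, j)) = 0 by rewrite /= (negPf ij).
  have := dist_T (g (Some (Some (i, j)))).
  rewrite !gE l1dist_origin_star_point // lvl0 addr0 => dist_ij.
  apply: (@graph_dist_edge _ _ w _ _ _ _ _ (d%:R * a + 2)) => //.
  - by move=> x; apply: l1dist_refl.
  - by move=> x y z; apply: l1dist_triangle.
  - by rewrite (can_eq gK).
  - move=> x; rewrite -(hK x) !(can_eq gK); case: (h x) => [u|] // _ ut.
    by rewrite !w_g; apply: star_point_detour.
  - by apply: le_lt_trans dist_ij _; rewrite lte_fin; lra.
rewrite (reindex g) /=; last exact: onW_bij.
rewrite big_mkcond !sum_option irrT add0r.
(* A possible edge to the center is dropped here, and those to the hubs [(i, i)] further on, leaving
   [d - 1] leaves for each [i]. *)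
rewrite -[leLHS]add0r lerD //; first by case: ifP.
rewrite (eq_bigr (fun p : 'I_d * 'I_d => if T (g None) (g (Some (Some (p.1, p.2))))
  then w (g None) (g (Some (Some (p.1, p.2)))) else 0)) => [|[i j] _ //].
rewrite -(pair_bigA _ (fun i j => if T (g None) (g (Some (Some (i, j))))
  then w (g None) (g (Some (Some (i, j)))) else 0)) /=.
rewrite (le_trans _ (ler_sum (F := fun=> (d%:R - 1) * (d%:R * a)) _ _)) //.
  by rewrite sumr_const card_ord -[leRHS]mulr_natl [leRHS]mulrA.
move=> i _; rewrite (bigD1 i) //= -[leLHS]add0r lerD //; first by case: ifP.
rewrite (eq_bigr (fun=> d%:R * a)) => [|j ji].
  rewrite sumr_const cardC1 card_ord -[leRHS]mulr_natl -subn1 natrB //.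
rewrite eq_sym in ji.
by rewrite edge // w_g l1dist_origin_star_point //= (negPf ji) addr0.
Qed.

(** * Choice of the constants and the final estimate *)

Theorem theorem1p6 (R : realType) :
  exists (eps0 : R) (eta : R -> R) (d0 : R -> nat),
    [/\ 0 < eps0,
        (forall eps : R, 0 < eps <= eps0 -> 0 <= eta eps),
        eta eps @[eps --> (0 : R)^'+] --> (0 : R),
        (forall eps : R, 0 < eps <= eps0 -> eps * (d0 eps)%:R < 1)
      & forall (eps : R) (d : nat),
          0 < eps <= eps0 -> (d0 eps <= d)%N -> eps * d%:R < 1 ->
          exists (P : {fset 'rV[R]_d}) (s : P),
            forall (beta : R) (T : rel P),
              l1_shallow_light_tree (1 + eps) beta s T ->
              (2 - eta eps) * eps^-1 < beta].
Proof.
exists (1 / 8), (fun eps => 80 * eps), (fun eps => Num.truncn (eps^-1 / 2)).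
split; first by lra.
- by move=> eps; lra.
- rewrite -[X in _ --> X](mulr0 80); apply: cvgM; first exact: cvg_cst.
  exact: cvg_at_right_filter.
- move=> eps /andP[eps_gt0 _].
  have /truncn_itv/andP[le_half _] : 0 <= eps^-1 / 2.
    by rewrite divr_ge0 ?invr_ge0 // ltW.
  apply: (@le_lt_trans _ _ (eps * (eps^-1 / 2))); first by rewrite ler_pM2l.
  by rewrite mulrA mulfV ?gt_eqF //; lra.
move=> eps d /andP[eps_gt0 eps_le] d_ge d_lt.
set X := eps^-1; have eX : eps * X = 1 by rewrite mulfV ?gt_eqF.
have X_ge8 : 8 <= X by rewrite -[8]invrK lef_pV2 ?posrE //; lra.
have D_lt : d%:R < X by rewrite -(ltr_pM2l eps_gt0) eX.
(* Truncation loses less than 1, so [d > X / 2 - 1 >= X / 4], as [X >= 8]. *)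
have D_ge : X / 4 <= d%:R.
  have : (Num.truncn (X / 2)).+1%:R <= d.+1%:R :> R by rewrite ler_nat.
  by rewrite -[d.+1]addn1 natrD => le_d; have := truncnS_gt (X / 2); lra.
set D := d%:R in D_lt D_ge.
have D_gt0 : 0 < D by lra.
(* This choice gives [d a = 2 X - 1], hence [eps d a = 2 - eps < 2]; and [a >= 1] because [D < X]
   and [X >= 8]. *)
have [||| P [s bound]] := @star_shallow_light_weight R d ((2 * X - 1) / D) eps.
- by rewrite -(ltr0n R).
- by rewrite ler_pdivlMr // mul1r; lra.
- by rewrite -/D [D * _]mulrC divfK ?gt_eqF //; lra.
exists P, s => beta T slt; have := bound beta T slt.
rewrite -/D [D * (_ / D)]mulrC divfK ?gt_eqF // => {}bound.
rewrite ltNge; apply/negP => beta_le.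
have : D * (D - 1) * (2 * X - 1) <= (2 * X - 80) * (2 * X - 1 + D ^+ 2).
  apply: le_trans bound _; apply: ler_wpM2r; first by nra.
  by apply: le_trans beta_le _; rewrite mulrBl -mulrA eX mulr1.
(* After the terms [2 X D^2] cancel, left side minus right side is
   [79 D^2 - 2 X D - 4 X^2 + D + 162 X - 80]. The negative quadratic terms cost at most
   [8 D^2 + 64 D^2], so the constant 80 in [eta] makes the difference positive. *)
have D2 : X ^+ 2 <= 16 * D ^+ 2 by nra.
have DX : X * D <= 4 * D ^+ 2 by nra.
nra.
Qed.
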